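(* Let $F$ be any subset of a metric space. For any $0<\theta_1 \leq \theta_2<1$ we have \[ \lvert \dim_\mathrm{A}^{\theta_1} F - \dim_\mathrm{A}^{\theta_2} F \rvert \ \leq \ \frac{\dim_\mathrm{A}F}{\theta_2(1-\theta_1)} \, \lvert\theta_1 - \theta_2 \rvert. \] In particular, the function $\theta \mapsto \dim_{\mathrm{A}}^\theta F$ is continuous in $\theta \in (0,1)$ and for any $\varepsilon>0$, the function $\theta \mapsto \dim_{\mathrm{A}}^\theta F$ is Lipschitz on the interval $[\varepsilon, 1-\varepsilon]$.
   Context: For a subset $E$ of a metric space and $r>0$, $N(E,r)$ denotes the minimal number of balls of radius $r$ required to cover $E$, and $B(x,R)$ is the ball of radius $R$ centred at $x$. The Assouad dimension of $F$ is \[ \dim_{\mathrm A} F = \inf\Big\{\alpha : \exists C>0,\ \exists \rho>0,\ \forall\, 0<r<R\leq\rho,\ \forall x\in F,\ N(B(x,R)\cap F,r)\leq C (R/r)^{\alpha}\Big\}. \] For $\theta\in(0,1)$, the Assouad spectrum of $F$ at $\theta$ is \[ \dim_{\mathrm A}^{\theta} F = \inf\Big\{\alpha : \exists C>0,\ \exists \rho>0,\ \forall\, 0<R\leq\rho,\ \forall x\in F,\ N(B(x,R)\cap F,R^{1/\theta})\leq C \big(R/R^{1/\theta}\big)^{\alpha}\Big\}. \]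
   Formalization: Continuity and the Lipschitz property are stated only when the Assouad dimension of F is finite (they can fail otherwise), and the inequality is stated whenever its left side is not ∞ − ∞; the empty set is given dimension 0. *)

(* Defs.v *)
From mathcomp Require Import all_boot all_order all_algebra.
From mathcomp Require Import all_classical all_reals all_analysis.

Set Implicit Arguments.
Unset Strict Implicit.
Unset Printing Implicit Defensive.

Import Order.TTheory GRing.Theory Num.Theory.
Import numFieldNormedType.Exports.

Local Open Scope classical_set_scope.
Local Open Scope ring_scope.

Definition covered_by {R : realType} {X : metricType R}
    (E : set X) (r : R) (n : nat) : Prop :=
  exists c : 'I_n -> X, E `<=` \bigcup_i ball (c i) r.

(* The library's [ball] is the open ball, and the centres range over the whole
   space.  The value is +oo when no finite cover exists. *)
Definition covering_number {R : realType} {X : metricType R}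
    (E : set X) (r : R) : \bar R :=
  ereal_inf [set (n%:R)%:E | n in covered_by E r].

(* The exponents are taken nonnegative: this is automatic when F is nonempty,
   because then covering numbers are at least 1 and R/r is unbounded, and it
   gives the empty set dimension 0.  The infimum of an empty set of exponents
   is +oo. *)
Definition assouad_dim {R : realType} {X : metricType R} (F : set X) : \bar R :=
  ereal_inf [set alpha%:E | alpha in [set alpha : R | 0 <= alpha /\
    exists C rho : R, [/\ 0 < C, 0 < rho &
      forall r R' : R, 0 < r -> r < R' -> R' <= rho ->
      forall x, F x ->
        (covering_number (ball x R' `&` F) r <=
         (C * (R' / r) `^ alpha)%:E)%E]]].

Definition assouad_spectrum {R : realType} {X : metricType R}
    (F : set X) (theta : R) : \bar R :=
  ereal_inf [set alpha%:E | alpha in [set alpha : R | 0 <= alpha /\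
    exists C rho : R, [/\ 0 < C, 0 < rho &
      forall R' : R, 0 < R' -> R' <= rho ->
      forall x, F x ->
        (covering_number (ball x R' `&` F) (R' `^ theta^-1) <=
         (C * (R' / R' `^ theta^-1) `^ alpha)%:E)%E]]].

(* Main.v *)
Require Import Defs.
From mathcomp Require Import all_boot all_order all_algebra.
From mathcomp Require Import all_classical all_reals all_analysis.
From mathcomp Require Import ring lra.
Import Order.TTheory GRing.Theory Num.Theory.
Import numFieldNormedType.Exports.
Local Open Scope classical_set_scope.
Local Open Scope ring_scope.
Set Implicit Arguments.
Unset Strict Implicit.
Unset Printing Implicit Defensive.

(** Write [u = 1/theta1 >= v = 1/theta2 > 1], let [s1], [s2] be the values of
the Assouad spectrum at [theta1 <= theta2] and [A] the Assouad dimension, and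
suppose that [A] is finite.  For [R <= 1] the scale [R^u] is finer than [R^v],
and the two spectra are compared by changing the scale of a cover.

- Refining: cover [B(x, R)] by balls of radius [R^v], and then each of these
  by balls of radius [R^u].  The first step costs about [R^((1-v) s2)] balls
  and the second about [R^((v-u) A)] for each of them, so that
  [(u - 1) s1 <= (v - 1) s2 + (u - v) A] ([spectrum_exponent_refine]).
- Coarsening: a cover by balls of radius [R^u] is enlarged to one by balls of
  radius [R^v], so that [(v - 1) s2 <= (u - 1) s1]
  ([spectrum_exponent_coarsen]).

After multiplication by [theta1 * theta2] these become
[theta1 (1 - theta2) s2 <= theta2 (1 - theta1) s1
<= theta1 (1 - theta2) s2 + (theta2 - theta1) A].  Since
[theta2 (1 - theta1) - theta1 (1 - theta2) = theta2 - theta1], subtracting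
[theta2 (1 - theta1) s2] gives
[- (theta2 - theta1) s2 <= theta2 (1 - theta1) (s1 - s2)
<= (theta2 - theta1) (A - s2)], and [0 <= s2 <= A] bounds both ends by
[(theta2 - theta1) A] in absolute value.  This is the required estimate
([fine_assouad_spectrum_dist]).

On [eps, 1 - eps] the factor [1 / (theta2 (1 - theta1))] is at most
[1 / eps^2], whence the Lipschitz property, and continuity follows because
every point of ]0, 1[ is interior to such an interval.  When the dimension is
infinite, the right-hand side is infinite unless [theta1 = theta2]. *)

(* The plain name also denotes a notion about families of sets. *)
Local Notation covered_by := Defs.covered_by.

(** * Counting covers *)

Section Covering.
Context {R : realType} {X : metricType R}.
Implicit Types (E F : set X) (r M : R).

(** The infimum defining a covering number is attained because it ranges over
natural numbers.  This turns bounds in the extended reals into covers. *)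
Lemma covering_number_leP E r M :
  (covering_number E r <= M%:E)%E <-> exists2 n, covered_by E r n & n%:R <= M.
Proof.
split=> [EM|[n En nM]]; last first.
  apply: (@le_trans _ _ n%:R%:E); last by rewrite lee_fin.
  by apply: ereal_inf_lbound; exists n.
have [[n En]|noE] := pselect (exists n, covered_by E r n); last first.
  move: EM; rewrite /covering_number.
  have -> : covered_by E r = set0.
    by apply/seteqP; split=> // n En; apply: noE; exists n.
  by rewrite image_set0 ereal_inf0.
have [|m /asboolP Em min_m] :=
    find_ex_minn (P := fun n => `[< covered_by E r n >]).
  by exists n; apply/asboolP.
exists m => //; rewrite -lee_fin; apply: le_trans EM.
apply: le_ereal_inf_tmp => _ [k /asboolP Ek <-].
by rewrite lee_fin ler_nat min_m.
Qed.

Lemma covered_by_fin E r (T : finType) (c : T -> X) :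
  E `<=` \bigcup_i ball (c i) r -> covered_by E r #|T|.
Proof.
move=> Ec; exists (c \o enum_val) => x /Ec[i _ xi].
by exists (enum_rank i); rewrite //= enum_rankK.
Qed.

(** A cover at scale [r] whose balls are each covered at scale [r'] by at most
[M] balls is refined by the disjoint union of the small covers. *)
Lemma covered_by_comp E r r' n M : covered_by E r n ->
  (forall y, exists2 m, covered_by (ball y r `&` E) r' m & m%:R <= M) ->
  exists2 k, covered_by E r' k & k%:R <= n%:R * M.
Proof.
move=> [c Ec] cov.
have /choice[m mP] : forall i : 'I_n, exists m,
    covered_by (ball (c i) r `&` E) r' m /\ m%:R <= M.
  by move=> i; have [m] := cov (c i); exists m.
(* Centres indexed by [nat] avoid a choice of functions with dependent domain. *)
have /choice[d dP] : forall i : 'I_n, exists d : nat -> X,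
    ball (c i) r `&` E `<=` \bigcup_(j in [set j | (j < m i)%N]) ball (d j) r'.
  move=> i; have [[d dP] _] := mP i.
  exists (fun k => if insub k is Some j then d j else c i) => x /dP[j _ xj].
  by exists (val j) => //=; rewrite valK.
pose T : finType := {i : 'I_n & 'I_(m i)}.
have Ed : E `<=` \bigcup_(p in [set: T]) ball (d (tag p) (tagged p)) r'.
  move=> x Ex; have [i _ xi] := Ec x Ex; have [j jm xj] := dP i x (conj xi Ex).
  by exists (Tagged (fun i => 'I_(m i)) (Ordinal jm)).
exists #|T|; first exact: covered_by_fin Ed.
rewrite card_tagged sumnE big_map big_enum /= natr_sum.
apply: le_trans (ler_sum (G := fun _ => M) _ _) _ => [i _|].
  by rewrite card_ord; case: (mP i).
by rewrite sumr_const card_ord mulr_natl.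
Qed.

Lemma covered_by_anti E r r' n :
  r' <= r -> covered_by E r' n -> covered_by E r n.
Proof.
move=> rr' [c Ec]; exists c => x /Ec[i _ xi].
by exists i => //; apply: le_ball xi.
Qed.

Lemma covered_by_sub E F r n : E `<=` F -> covered_by F r n -> covered_by E r n.
Proof. by move=> EF [c Fc]; exists c; apply: subset_trans Fc. Qed.

End Covering.

(** * Admissible exponents *)

Section Exponents.
Context {R : realType} {X : metricType R}.
Variable F : set X.

Definition is_assouad_exponent (b : R) : Prop := 0 <= b /\
  exists C rho : R, [/\ 0 < C, 0 < rho &
    forall r R' : R, 0 < r -> r < R' -> R' <= rho ->
    forall x, F x ->
      (covering_number (ball x R' `&` F) r <= (C * (R' / r) `^ b)%:E)%E].

Definition is_spectrum_exponent (theta a : R) : Prop := 0 <= a /\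
  exists C rho : R, [/\ 0 < C, 0 < rho &
    forall R' : R, 0 < R' -> R' <= rho ->
    forall x, F x ->
      (covering_number (ball x R' `&` F) (R' `^ theta^-1) <=
       (C * (R' / R' `^ theta^-1) `^ a)%:E)%E].

Lemma powR_quot (x p q a : R) : 0 < x ->
  (x `^ p / x `^ q) `^ a = x `^ ((p - q) * a).
Proof.
by move=> x0; rewrite powRrM powRB // (gt_eqF x0) implybT.
Qed.

(** The working form of the definition: explicit covers, one power of the
scale [s], and a threshold at most [1] so that [s `^ p]
decreases in [p]. *)
Lemma spectrum_exponentP theta a : is_spectrum_exponent theta a <-> 0 <= a /\
  exists C rho : R, [/\ 0 < C, 0 < rho <= 1 &
    forall s : R, 0 < s -> s <= rho -> forall x, F x ->
      exists2 n, covered_by (ball x s `&` F) (s `^ theta^-1) n &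
        n%:R <= C * s `^ ((1 - theta^-1) * a)].
Proof.
split=> -[a0 [C [rho [C0 rho0 Crho]]]]; split=> //.
  exists C, (Num.min 1 rho); split=> //.
    by rewrite lt_min ltr01 rho0 ge_min lexx.
  move=> s s0; rewrite le_min => /andP[_ srho] x Fx.
  apply/covering_number_leP; rewrite -powR_quot // (powRr1 (ltW s0)).
  exact: Crho.
case/andP: rho0 => rho0 _; exists C, rho; split=> // s s0 srho x Fx.
apply/covering_number_leP.
by rewrite -{3}(powRr1 (ltW s0)) powR_quot//; apply: Crho.
Qed.

(** The spectrum only tests the pairs of scales [(R, R^(1/theta))]. *)
Lemma assouad_spectrum_exponent theta b : 0 < theta < 1 ->
  is_assouad_exponent b -> is_spectrum_exponent theta b.
Proof.
move=> /andP[t0 t1] [b0 [C [rho [C0 rho0 Crho]]]]; split=> //.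
(* The constant 1/2 keeps [s < 1], hence [s `^ theta^-1 < s] strictly. *)
exists C, (Num.min (2^-1) rho); split=> //.
  by rewrite lt_min rho0 invr_gt0 ltr0n.
move=> s s0; rewrite le_min => /andP[s2 srho] x Fx.
apply: Crho => //; first exact: powR_gt0.
have ti1 : 1 < theta^-1 by rewrite invf_gt1.
rewrite -[ltRHS]powRr1 1?ltW// /powR !gt_eqF// ltr_expR.
have : ln s < 0 by rewrite ln_lt0// s0/=; apply: le_lt_trans s2 _; lra.
by move=> ls; rewrite ltr_nM2r.
Qed.

(** The balls of a cover need not be centred in [F], whereas the definition of
the Assouad dimension only speaks of balls that are.  A ball of radius [r] that
meets [F] at [z] is contained in the ball of radius [2 * r] about [z], at the
cost of a constant factor; one that misses [F] needs no ball at all. *)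
Lemma assouad_exponent_cover b : is_assouad_exponent b ->
  exists C rho : R, [/\ 0 < C, 0 < rho &
    forall r r' : R, 0 < r' -> r' <= r -> r <= rho ->
    forall y, exists2 m, covered_by (ball y r `&` F) r' m &
      m%:R <= C * (r / r') `^ b].
Proof.
move=> [b0 [C [rho [C0 rho0 Crho]]]].
exists (C * 2 `^ b), (rho / 2); split; first by rewrite mulr_gt0 ?powR_gt0.
  by rewrite divr_gt0.
move=> r r' r'0 r'r rrho y.
have r0 : 0 < r by apply: lt_le_trans r'r.
have [[z [yz Fz]]|noz] := pselect (ball y r `&` F !=set0); last first.
  exists 0%N; last by rewrite !mulr_ge0// ?powR_ge0// ltW.
  by exists (fun=> y) => x yx; case: noz; exists x.
have r'2r : r' < 2 * r by lra.
have r2rho : 2 * r <= rho by lra.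
have /covering_number_leP[m mc mle] := Crho _ _ r'0 r'2r r2rho z Fz.
exists m.
  apply: covered_by_sub mc => x [yx Fx]; split=> //.
  have -> : 2 * r = r + r by ring.
  exact: ball_triangle (ball_sym yz) yx.
apply: le_trans mle _.
by rewrite -!mulrA -powRM// divr_ge0// ltW.
Qed.

(** Reaching the scale [s^(1/theta1)] through the intermediate scale
[s^(1/theta2)], with the Assouad exponent governing the second step.  The
resulting exponent is the solution [c] of
[(theta1^-1 - 1) c = (theta2^-1 - 1) a + (theta1^-1 - theta2^-1) b]. *)
Lemma spectrum_exponent_refine theta1 theta2 a b :
  0 < theta1 -> theta1 <= theta2 -> theta2 < 1 ->
  is_spectrum_exponent theta2 a -> is_assouad_exponent b ->
  is_spectrum_exponent theta1
    (((theta2^-1 - 1) * a + (theta1^-1 - theta2^-1) * b) / (theta1^-1 - 1)).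
Proof.
move=> t10 t12 t21 /spectrum_exponentP[a0 [C [rho [C0 rho01 Ca]]]] Ab.
case/andP: rho01 => rho0 rho1.
have b0 : 0 <= b by case: Ab.
have [D [rho' [D0 rho'0 Db]]] := assouad_exponent_cover Ab.
have t20 : 0 < theta2 by apply: lt_le_trans t12.
have uv : theta2^-1 <= theta1^-1 by rewrite lef_pV2.
have v1 : 1 < theta2^-1 by rewrite invf_gt1.
set u := theta1^-1 in uv *; set v := theta2^-1 in uv v1 Ca *.
have u1 : 1 < u by apply: lt_le_trans uv.
apply/spectrum_exponentP; split.
  by apply: divr_ge0; [apply: addr_ge0; apply: mulr_ge0|]; lra.
exists (C * D), (Num.min rho rho'); split; first exact: mulr_gt0.
  by rewrite lt_min rho0 rho'0 ge_min rho1.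
move=> s s0; rewrite le_min => /andP[srho srho'] x Fx.
have s1 : 0 < s <= 1 by rewrite s0 (le_trans srho).
have [n nc nle] := Ca s s0 srho x Fx.
have sv : s `^ v <= rho'.
  by apply: le_trans srho'; rewrite ge1r_powR// ltW.
have suv : s `^ u <= s `^ v by apply: ger_powR.
have [|k kc kle] := @covered_by_comp R X _ _ (s `^ u) _
  (D * (s `^ v / s `^ u) `^ b) nc.
  move=> y; have [m mc mle] := Db _ _ (powR_gt0 _ s0) suv sv y.
  by exists m => //; apply: covered_by_sub mc => z [yz [_ Fz]].
exists k => //; apply: le_trans kle _; rewrite powR_quot//.
have -> : (1 - u) * (((v - 1) * a + (u - v) * b) / (u - 1)) =
    (1 - v) * a + (v - u) * b.
  by field; rewrite subr_eq0 gt_eqF.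
rewrite powRD ?(gt_eqF s0) ?implybT//.
rewrite [leRHS]mulrACA ler_wpM2r// mulr_ge0 ?powR_ge0// ltW//.
Qed.

(** A cover at the finer scale [s^(1/theta1)] is one at the scale
[s^(1/theta2)]; the exponent is renormalised to the new ratio of scales. *)
Lemma spectrum_exponent_coarsen theta1 theta2 a :
  0 < theta1 -> theta1 <= theta2 -> theta2 < 1 ->
  is_spectrum_exponent theta1 a ->
  is_spectrum_exponent theta2 ((theta1^-1 - 1) * a / (theta2^-1 - 1)).
Proof.
move=> t10 t12 t21 /spectrum_exponentP[a0 [C [rho [C0 rho01 Ca]]]].
have t20 : 0 < theta2 by apply: lt_le_trans t12.
have uv : theta2^-1 <= theta1^-1 by rewrite lef_pV2.
have v1 : 1 < theta2^-1 by rewrite invf_gt1.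
set u := theta1^-1 in uv Ca *; set v := theta2^-1 in uv v1 *.
have u1 : 1 < u by apply: lt_le_trans uv.
apply/spectrum_exponentP; split.
  by apply: divr_ge0; [apply: mulr_ge0|]; lra.
exists C, rho; split=> // s s0 srho x Fx.
have [n nc nle] := Ca s s0 srho x Fx.
have s1 : 0 < s <= 1 by rewrite s0 (le_trans srho); case/andP: rho01.
exists n; first by apply: covered_by_anti nc; apply: ger_powR.
have -> // : (1 - v) * ((u - 1) * a / (v - 1)) = (1 - u) * a.
by field; rewrite subr_eq0 gt_eqF.
Qed.

End Exponents.

(** * From exponents to dimensions *)

(** Passes a linear inequality between exponents to their infimum. *)
Lemma ereal_inf_affine {R : realType} (S : set R) (s c d k : R) :
  ereal_inf (EFin @` S) = s%:E -> 0 < c ->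
  (forall a, S a -> k <= c * a + d) -> k <= c * s + d.
Proof.
move=> Ss c0 kS; rewrite -lerBlDr mulrC -ler_pdivrMr// -lee_fin -Ss.
apply: le_ereal_inf_tmp => _ [a /kS ka <-].
by rewrite lee_fin ler_pdivrMr// mulrC lerBlDr.
Qed.

Section Dimension.
Context {R : realType} {X : metricType R}.
Variable F : set X.

Lemma assouad_spectrum_ge0 theta : (0 <= assouad_spectrum F theta)%E.
Proof. by apply: le_ereal_inf_tmp => _ [a [a0 _] <-]; rewrite lee_fin. Qed.

Lemma assouad_dim_ge0 : (0 <= assouad_dim F)%E.
Proof. by apply: le_ereal_inf_tmp => _ [a [a0 _] <-]; rewrite lee_fin. Qed.

Lemma assouad_spectrum_le theta s a : assouad_spectrum F theta = s%:E ->
  is_spectrum_exponent F theta a -> s <= a.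
Proof.
by move=> Es Sa; rewrite -lee_fin -Es; apply: ereal_inf_lbound; exists a.
Qed.

Lemma assouad_spectrum_le_dim theta : 0 < theta < 1 ->
  (assouad_spectrum F theta <= assouad_dim F)%E.
Proof.
move=> t01; apply: le_ereal_inf_tmp => _ [b Ab <-].
by apply: ereal_inf_lbound; exists b => //; exact: assouad_spectrum_exponent.
Qed.

Lemma assouad_spectrum_fin theta : (assouad_dim F < +oo)%E -> 0 < theta < 1 ->
  assouad_spectrum F theta \is a fin_num.
Proof.
move=> Foo t01; rewrite ge0_fin_numE ?assouad_spectrum_ge0//.
exact: le_lt_trans (assouad_spectrum_le_dim t01) Foo.
Qed.

(** The quantitative estimate: the refining and coarsening bounds hold for all
admissible exponents, hence for their infima, and are linear in them. *)
Lemma fine_assouad_spectrum_dist theta1 theta2 : (assouad_dim F < +oo)%E ->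
  0 < theta1 -> theta1 <= theta2 -> theta2 < 1 ->
  `|fine (assouad_spectrum F theta1) - fine (assouad_spectrum F theta2)| <=
  fine (assouad_dim F) / (theta2 * (1 - theta1)) * (theta2 - theta1).
Proof.
move=> Foo t10; rewrite le_eqVlt => /predU1P[<- t11|t12 t21].
  by rewrite !subrr normr0 mulr0.
have t20 : 0 < theta2 by apply: lt_trans t12.
have t11 : theta1 < 1 by apply: lt_trans t21.
have t1P : 0 < theta1 < 1 by rewrite t10.
have t2P : 0 < theta2 < 1 by rewrite t20.
have := assouad_spectrum_le_dim t2P.
have : assouad_dim F \is a fin_num by rewrite ge0_fin_numE ?assouad_dim_ge0.
have := assouad_spectrum_ge0 theta2.
have := assouad_spectrum_fin Foo t1P; have := assouad_spectrum_fin Foo t2P.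
case E2: (assouad_spectrum F theta2) => [s2| |]// _.
case E1: (assouad_spectrum F theta1) => [s1| |]// _ /= s20.
case EA: (assouad_dim F) => [A| |]// _ /= s2A.
rewrite !lee_fin in s20 s2A.
have uv : theta2^-1 < theta1^-1 by rewrite ltf_pV2.
have v1 : 1 < theta2^-1 by rewrite invf_gt1.
have u1 : 1 < theta1^-1 by apply: lt_trans uv.
have refine : (theta1^-1 - 1) * s1 <=
    (theta2^-1 - 1) * s2 + (theta1^-1 - theta2^-1) * A.
  rewrite [leRHS]addrC; apply: (ereal_inf_affine EA) => [|b Ab].
    by rewrite subr_gt0.
  rewrite [leRHS]addrC; apply: (ereal_inf_affine E2) => [|a Sa].
    by rewrite subr_gt0.
  rewrite mulrC -ler_pdivlMr ?subr_gt0//.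
  exact: assouad_spectrum_le E1
    (spectrum_exponent_refine t10 (ltW t12) t21 Sa Ab).
have coarsen : (theta2^-1 - 1) * s2 <= (theta1^-1 - 1) * s1.
  rewrite -[leRHS]addr0; apply: (ereal_inf_affine E1) => [|a Sa].
    by rewrite subr_gt0.
  rewrite addr0 mulrC -ler_pdivlMr ?subr_gt0//.
  exact: assouad_spectrum_le E2
    (spectrum_exponent_coarsen t10 (ltW t12) t21 Sa).
(* Multiplying by [theta1 * theta2] clears the inverses. *)
have t12_gt0 : 0 < theta1 * theta2 by exact: mulr_gt0.
have {}refine : theta2 * (1 - theta1) * s1 <=
    theta1 * (1 - theta2) * s2 + (theta2 - theta1) * A.
  have := ler_wpM2l (ltW t12_gt0) refine.
  congr (_ <= _); field; rewrite ?gt_eqF//.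
have {}coarsen : theta1 * (1 - theta2) * s2 <= theta2 * (1 - theta1) * s1.
  have := ler_wpM2l (ltW t12_gt0) coarsen.
  congr (_ <= _); field; rewrite ?gt_eqF//.
have w0 : 0 < theta2 * (1 - theta1) by rewrite mulr_gt0 ?subr_gt0.
rewrite mulrAC ler_pdivlMr// -[X in _ * X](gtr0_norm w0) -normrM ler_norml.
have d0 : 0 < theta2 - theta1 by rewrite subr_gt0.
(* The lower bound uses [s2 <= A], the upper one [0 <= s2]. *)
have := ler_wpM2l (ltW d0) s2A.
have := mulr_ge0 (ltW d0) s20.
by move=> h1 h2; apply/andP; split; lra.
Qed.

Lemma fine_assouad_spectrum_klipschitz eps : (assouad_dim F < +oo)%E ->
  0 < eps ->
  (fine (assouad_dim F) / (eps * eps)).-lipschitz_(`[eps, 1 - eps])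
    (fun theta => fine (assouad_spectrum F theta)).
Proof.
move=> Foo eps0.
have A0 : 0 <= fine (assouad_dim F) by rewrite fine_ge0 ?assouad_dim_ge0.
suff le12 t1 t2 : eps <= t1 -> t1 <= t2 -> t2 <= 1 - eps ->
    `|fine (assouad_spectrum F t1) - fine (assouad_spectrum F t2)| <=
    fine (assouad_dim F) / (eps * eps) * (t2 - t1).
  move=> [x y] /= [/=]; rewrite !in_itv/= => /andP[x0 x1] /andP[y0 y1].
  have [xy|/ltW yx] := leP x y.
    by rewrite (distrC x y) (ger0_norm (_ : 0 <= y - x)) ?subr_ge0// le12.
  by rewrite distrC (ger0_norm (_ : 0 <= x - y)) ?subr_ge0// le12.
move=> t1e t12 t2e; have t10 : 0 < t1 by apply: lt_le_trans t1e.
apply: le_trans (fine_assouad_spectrum_dist Foo t10 t12 _) _; first lra.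
rewrite ler_wpM2r ?subr_ge0// ler_wpM2l// lef_pV2 ?posrE ?mulr_gt0//; try lra.
by apply: ler_pM; lra.
Qed.

End Dimension.

(** * Continuity *)

Lemma klipschitz_continuous_at {R : realType} (f : R -> R) (k a b x : R) :
  k.-lipschitz_(`[a, b]) f -> a < x < b -> {for x, continuous f}.
Proof.
move=> kf axb.
have xab : x \in `]a, b[ by rewrite in_itv.
apply/cvgrPdist_le => e e0.
(* The [+ 1] and the absolute value cover the case [k <= 0]. *)
have d0 : 0 < e / (`|k| + 1) by rewrite divr_gt0// ltr_wpDl.
near=> y.
have yab : y \in `]a, b[ by near: y; exact: near_in_itvoo.
have xy : `|x - y| <= e / (`|k| + 1).
  by near: y; exact: cvgr_dist_le (@cvg_id _ (nbhs x)) _ d0.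
apply: le_trans (kf (x, y) _) _; first by split; apply: subset_itv_oo_cc.
move: xy; rewrite ler_pdivlMr ?ltr_wpDl// => xy.
apply: le_trans xy; rewrite mulrC ler_wpM2l//.
by have := ler_norm k; lra.
Unshelve. all: by end_near. Qed.

(* The difference on the left is meaningful except when both terms are +oo
   (the side condition [+?]); this never happens if the Assouad dimension
   is finite, since then the spectrum is finite. *)
Theorem corollary3p5 (R : realType) (X : metricType R) (F : set X) :
  (forall theta1 theta2 : R, 0 < theta1 -> theta1 <= theta2 -> theta2 < 1 ->
     (assouad_spectrum F theta1 +? - assouad_spectrum F theta2)%E ->
     (`|assouad_spectrum F theta1 - assouad_spectrum F theta2| <=
      assouad_dim F * ((theta2 * (1 - theta1))^-1)%:E *
      (`|theta1 - theta2|)%:E)%E)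
  /\
  ((assouad_dim F < +oo)%E ->
     [/\ forall theta : R, 0 < theta -> theta < 1 ->
           assouad_spectrum F theta \is a fin_num,
         {within `]0, 1[, continuous
           (fun theta : R => fine (assouad_spectrum F theta))} &
         forall eps : R, 0 < eps ->
           [lipschitz fine (assouad_spectrum F theta)
             | theta in `[eps, 1 - eps]] ]).
Proof.
split=> [theta1 theta2 t10 t12 t21 t12def|Foo].
  have t20 : 0 < theta2 by apply: lt_le_trans t12.
  have t11 : theta1 < 1 by apply: le_lt_trans t21.
  have [Foo|] := ltP (assouad_dim F) +oo%E; last first.
    rewrite leye_eq => /eqP Foo.
    (* For equal parameters both sides vanish, since [+?] excludes +oo - +oo;
       otherwise the right-hand side is +oo. *)
    move: t12 t12def; rewrite le_eqVlt => /predU1P[<-|t12 _].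
      case: (assouad_spectrum F theta1) => [s| |]//=.
      by rewrite !subrr !normr0 mule0.
    have w0 : 0 < (theta2 * (1 - theta1))^-1.
      by rewrite invr_gt0 mulr_gt0 ?subr_gt0.
    have d0 : 0 < `|theta1 - theta2| by rewrite normr_gt0 subr_eq0 lt_eqF.
    by rewrite Foo !gt0_mulye ?lte_fin// leey.
  have t12_norm : `|theta1 - theta2| = theta2 - theta1.
    by rewrite distrC ger0_norm ?subr_ge0.
  have dist12 := fine_assouad_spectrum_dist Foo t10 t12 t21.
  have t1P : 0 < theta1 < 1 by rewrite t10.
  have t2P : 0 < theta2 < 1 by rewrite t20.
  have dim_fin : assouad_dim F \is a fin_num.
    by rewrite ge0_fin_numE ?assouad_dim_ge0.
  rewrite -(fineK (assouad_spectrum_fin Foo t1P)).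
  rewrite -(fineK (assouad_spectrum_fin Foo t2P)) -(fineK dim_fin).
  by rewrite -EFinB abse_EFin -!EFinM lee_fin t12_norm.
split=> [theta t0 t1||eps eps0].
- by apply: assouad_spectrum_fin; rewrite ?t0.
- rewrite continuous_open_subspace; last exact: interval_open.
  move=> x; rewrite inE /= in_itv /= => /andP[x0 x1].
  set eps := Num.min x (1 - x) / 2.
  have m0 : 0 < Num.min x (1 - x) by rewrite lt_min x0 subr_gt0.
  have mx : Num.min x (1 - x) <= x by rewrite ge_min lexx.
  have mx1 : Num.min x (1 - x) <= 1 - x by rewrite ge_min lexx orbT.
  apply: (klipschitz_continuous_at
    (fine_assouad_spectrum_klipschitz (eps := eps) Foo _)); rewrite /eps; lra.
- have kl := fine_assouad_spectrum_klipschitz Foo eps0.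
  rewrite /lipschitz_on; near=> M => -[x y] xy /=.
  have /= klxy := kl (x, y) xy.
  apply: le_trans klxy _.
  by apply: ler_wpM2r => //; near: M; apply: nbhs_pinfty_ge; exact: num_real.
Unshelve. all: by end_near. Qed.
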